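(* Let $(\mathcal U,U,V)$ be a metric $f$-structure. Let $\mathscr V$ be a real vector space and $\psi\colon\mathscr V\to V^+$ a symmetric, sublinear map. Let $(\mathscr M_{\langle\psi\rangle},T_{\langle\psi\rangle})$ be the $V$-Banach $U$-module generated by $\psi$ together with its canonical linear map. Then $(\mathscr M_{\langle\psi\rangle},T_{\langle\psi\rangle})$ is the initial object of the category $\mathbf C_\psi$, i.e. for any object $(\mathscr M,T)$ of $\mathbf C_\psi$ there exists a unique morphism $\Phi\colon(\mathscr M_{\langle\psi\rangle},T_{\langle\psi\rangle})\to(\mathscr M,T)$ in $\mathbf C_\psi$.
   Context: Riesz spaces and $f$-algebras. $\mathbb R^+=[0,\infty)$. A Riesz space is a real vector space $U$ with a partial order that is a lattice and satisfies $u\le v\Rightarrow u+w\le v+w$ and ($u\ge 0$, $\lambda\in\mathbb R^+$) $\Rightarrow\lambda u\ge 0$; $\vee,\wedge$ denote sup and inf of two elements, $u^{+}=u\vee 0$, $u^-=(-u)\vee 0$, $|u|=u\vee(-u)$, $U^+=\{u\in U:u\ge 0\}$. A Riesz subspace is a linear subspace closed under $\vee,\wedge$; a Riesz subspace $V\subset U$ is solid if $v\in U$, $u\in V$, $|v|\le|u|$ imply $v\in V$. A family is disjoint if $|u|\wedge|v|=0$ for any two different members. Dedekind $\sigma$-complete: every countable non-empty subset bounded above has a supremum and every countable non-empty subset bounded below has an infimum. An $f$-algebra is a Riesz space with an associative, commutative, $\mathbb R$-bilinear multiplication with unit $\mathbf 1_U$ such that $uv\ge0$ for $u,v\ge 0$,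 and $(uw)\wedge v=0$ whenever $u\wedge v=0$ and $w\ge 0$. An $f$-subalgebra is a Riesz subspace closed under multiplication and containing $\mathbf 1_U$. $\mathrm{Idem}(U)=\{u\in U:u^2=u\}$. A finite partition of $u\in\mathrm{Idem}(U)$ is a finite disjoint family in $\mathrm{Idem}(U)$ with sum $u$; a countable partition of $u$ is a disjoint family $(u_n)_{n\in\mathbb N}\subset\mathrm{Idem}(U)$ with $\sup_n u_n=u$; $\mathcal P(u)$ is the set of countable partitions of $u$. Simple elements: $\mathcal S(U)=\{\sum_{i=1}^n\lambda_iu_i:\lambda_i\in\mathbb R,\ (u_i)_{i=1}^n\text{ a finite partition of }\mathbf 1_U\}$. An order-preserving map is $\sigma$-order-continuous if it preserves existing suprema of non-decreasing sequences and existing infima of non-increasing sequences. A localisable $f$-algebra is a Dedekind $\sigma$-complete $f$-algebra whose multiplication is $\sigma$-order-continuous on $U^+\times U^+$ and such that every $u\in U^+$ is the supremum of a non-decreasing sequence in $\mathcal S(U)\cap U^+$. Metric notions (products of metric spaces carry the sum distance). A metric Riesz space $(U,\mathsf d_U)$ is a Dedekind $\sigma$-complete Riesz space with a complete distance such that $\mathsf d_U(u,0)=\mathsf d_U(|u|,0)$, $\mathsf d_U(u+w,v+w)=\mathsf d_U(u,v)$, and $\mathsf d_U(u,0)\le\mathsf d_U(v,0)$ whenever $0\le u\le v$. A metric $f$-algebra is a localisable $f$-algebra $U$ with a distance $\mathsf d_U$ such that $(U,\mathsf d_U)$ is a metric Riesz space, the multiplication $U\times U\to U$ is continuous, $\mathcal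 S(U)$ is dense, and $\mathsf d_U(\varepsilon\mathbf 1_U,0)\to0$ as $\varepsilon\searrow0$. A metric $f$-structure is a triple $(\mathcal U,U,V)$ where $\mathcal U$ is a localisable $f$-algebra; $(U,\mathsf d_U)$ is a metric $f$-algebra that is a solid $f$-subalgebra of $\mathcal U$; $(V,\mathsf d_V)$ is a metric Riesz space that is a solid Riesz subspace of $\mathcal U$; $UV=V$ (where $UV=\{uv:u\in U,v\in V\}$) and the multiplication $U\times V\to V$ is continuous; and for any $(u_n)_n\in\mathcal P(\mathbf 1_U)$ and $\varepsilon>0$ there is $\delta>0$ such that, whenever $(v_n)_n\subset V^+$ satisfies $\sum_n\mathsf d_V(u_nv_n,0)\le\delta$, the family $(u_nv_n)_n$ is order-bounded in $V$ and $\mathsf d_V(\sup_nu_nv_n,0)\le\varepsilon$. Modules. A $V$-normed $U$-module is a $U$-module $\mathscr M$ (a real vector space via $\lambda v=(\lambda\mathbf 1_U)\cdot v$) with a map $|\cdot|\colon\mathscr M\to V^+$ such that $|v|=0\iff v=0$, $|v+w|\le|v|+|w|$, $|u\cdot v|=|u||v|$, and the glueing property holds: if $(u_n)_n\in\mathcal P(\mathbf 1_U)$ and $(v_n)_n\subset\mathscr M$ are such that $(|u_n\cdot v_n|)_n$ is order-bounded in $V$ (one writes $(u_n,v_n)_n\in\mathrm{Adm}(\mathscr M)$), then there is a (necessarily unique) $v\in\mathscr M$ with $u_n\cdot v=u_n\cdot v_n$ for all $n$, denoted $\sum_{n\in\mathbb N}u_n\cdot v_n$. $\mathscr M$ has the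 distance $\mathsf d_{\mathscr M}(v,w)=\mathsf d_V(|v-w|,0)$; if it is complete, $\mathscr M$ is a $V$-Banach $U$-module. For $\varnothing\ne S\subset\mathscr M$, $\mathscr G(S)=\{\sum_nu_n\cdot v_n:(u_n)_n\in\mathcal P(\mathbf 1_U),(v_n)_n\subset S,(u_n,v_n)_n\in\mathrm{Adm}(\mathscr M)\}$. Morphisms in the category $\mathbf{BanMod}_{(\mathcal U,U,V)}$ of $V$-Banach $U$-modules are the $U$-linear maps $T$ with $|Tv|\le|v|$ for all $v$. A map $\psi\colon\mathscr V\to V^+$ is sublinear if $\psi(\lambda\mathsf v)=\lambda\psi(\mathsf v)$ for $\lambda\in\mathbb R^+$ and $\psi(\mathsf v+\mathsf w)\le\psi(\mathsf v)+\psi(\mathsf w)$; it is symmetric if $\psi(-\mathsf v)=\psi(\mathsf v)$. The couple $(\mathscr M_{\langle\psi\rangle},T_{\langle\psi\rangle})$ consists of a $V$-Banach $U$-module and a linear map $T_{\langle\psi\rangle}\colon\mathscr V\to\mathscr M_{\langle\psi\rangle}$ such that $|T_{\langle\psi\rangle}\mathsf v|=\psi(\mathsf v)$ for all $\mathsf v\in\mathscr V$ and $\mathscr G(T_{\langle\psi\rangle}(\mathscr V))$ is dense in $\mathscr M_{\langle\psi\rangle}$ (such a couple exists and is unique up to unique isomorphism). The category $\mathbf C_\psi$: objects are couples $(\mathscr M,T)$ with $\mathscr M$ a $V$-Banach $U$-module and $T\colon\mathscr V\to\mathscr M$ linear with $|T\mathsf v|\le\psi(\mathsf v)$ for all $\mathsf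 v\in\mathscr V$; morphisms $(\mathscr M_1,T_1)\to(\mathscr M_2,T_2)$ are the morphisms $\Phi\colon\mathscr M_1\to\mathscr M_2$ of $\mathbf{BanMod}_{(\mathcal U,U,V)}$ with $\Phi\circ T_1=T_2$. *)

(* Defs.v *)
From HB Require Import structures.
From mathcomp Require Import all_boot all_order all_algebra.
From mathcomp Require Import all_classical all_reals all_analysis.
Import Order.TTheory GRing.Theory Num.Theory.
Import numFieldNormedType.Exports.

Set Implicit Arguments.
Unset Strict Implicit.
Unset Printing Implicit Defensive.
Set Warnings "-redundant-canonical-projection".

Local Open Scope classical_set_scope.
Local Open Scope ring_scope.

(* The lattice operations are fields: Hierarchy Builder accepts no structure
   inheriting from both [Order.Lattice] and [GRing.Zmodule], because
   [Num.RealDomain] already inherits from both and they have no join. *)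
HB.mixin Record isRiesz (R : realType) U
    of Num.POrderedZmodule U & GRing.Lmodule R U := {
  joinr : U -> U -> U;
  meetr : U -> U -> U;
  joinr_sup : forall u v : U, supremums [set u; v] (joinr u v);
  meetr_inf : forall u v : U, infimums [set u; v] (meetr u v);
  riesz_leD2r : forall u v w : U, u <= v -> u + w <= v + w;
  riesz_scale_ge0 : forall (l : R) (u : U), 0 <= l -> 0 <= u -> 0 <= l *: u
}.

#[short(type="rieszType")]
HB.structure Definition Riesz (R : realType) :=
  {U of Num.POrderedZmodule U & GRing.Lmodule R U & isRiesz R U}.

Section RieszDefs.
Context (R : realType) (U : rieszType R).

Definition absr (u : U) : U := joinr u (- u).

Definition solid (A : set U) :=
  forall u v : U, A u -> absr v <= absr u -> A v.

(* Members are told apart by their indices, so that a repeated member has to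
   be disjoint from itself. *)
Definition disjoint_family (I : Type) (u : I -> U) :=
  forall i j, i <> j -> meetr (absr (u i)) (absr (u j)) = 0.

Definition order_bounded (A : set U) := has_lbound A /\ has_ubound A.

End RieszDefs.

HB.mixin Record isDedekindRiesz (R : realType) U of Riesz R U := {
  countable_sup : forall A : set U,
    countable A -> A !=set0 -> has_ubound A -> supremums A !=set0;
  countable_inf : forall A : set U,
    countable A -> A !=set0 -> has_lbound A -> infimums A !=set0
}.

#[short(type="dedekindRieszType")]
HB.structure Definition DedekindRiesz (R : realType) :=
  {U of Riesz R U & isDedekindRiesz R U}.

(* The product is a field for the same reason (orders and rings meet in
   [Num.NumDomain]); [falg_ring] below is the ring. The zero f-algebra is not
   excluded. *)
HB.mixin Record isFAlgebra (R : realType) U of Riesz R U := {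
  falg_one : U;
  falg_mul : U -> U -> U;
  falg_mulA : associative falg_mul;
  falg_mulC : commutative falg_mul;
  falg_mul1 : left_id falg_one falg_mul;
  falg_mulDl : left_distributive falg_mul +%R;
  falg_mulZl : forall (l : R) (u v : U),
    falg_mul (l *: u) v = l *: falg_mul u v;
  falg_mul_ge0 : forall u v : U, 0 <= u -> 0 <= v -> 0 <= falg_mul u v;
  falg_mul_disjoint : forall u v w : U,
    meetr u v = 0 -> 0 <= w -> meetr (falg_mul u w) v = 0
}.

#[short(type="fAlgebraType")]
HB.structure Definition FAlgebra (R : realType) :=
  {U of Riesz R U & isFAlgebra R U}.

Definition falg_ring (R : realType) (U : fAlgebraType R) : Type := U.

HB.instance Definition _ (R : realType) (U : fAlgebraType R) :=
  GRing.Zmodule.on (falg_ring U).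
HB.instance Definition _ (R : realType) (U : fAlgebraType R) :=
  GRing.Zmodule_isComPzRing.Build (falg_ring U)
    (@falg_mulA R U) (@falg_mulC R U) (@falg_mul1 R U) (@falg_mulDl R U).

Section FAlgebraDefs.
Context (R : realType) (U : fAlgebraType R).

Definition idem : set U := [set u | falg_mul u u = u].

Definition finite_partition (u : U) (n : nat) (p : 'I_n -> U) :=
  [/\ forall i, idem (p i), disjoint_family p & \sum_(i < n) p i = u].

Definition countable_partition (u : U) (p : nat -> U) :=
  [/\ forall n, idem (p n), disjoint_family p & supremums (range p) u].

Definition simple : set U :=
  [set x | exists (n : nat) (l : 'I_n -> R) (p : 'I_n -> U),
     finite_partition falg_one p /\ x = \sum_(i < n) l i *: p i].

End FAlgebraDefs.

(* The suprema and infima are those of the subposets [D] and [E]. *)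
Definition sigma_order_continuous d d' (S : porderType d) (T : porderType d')
    (D : set S) (E : set T) (f : S -> T) :=
  [/\ forall x, D x -> E (f x),
      forall x y, D x -> D y -> (x <= y)%O -> (f x <= f y)%O,
      forall (s : nat -> S) (x : S), (forall n, D (s n)) ->
        (forall m n, (m <= n)%N -> (s m <= s n)%O) ->
        let ub := D `&` ubound (range s) in
        let ub' := E `&` ubound (range (f \o s)) in
        (ub `&` lbound ub) x -> (ub' `&` lbound ub') (f x)
    & forall (s : nat -> S) (x : S), (forall n, D (s n)) ->
        (forall m n, (m <= n)%N -> (s n <= s m)%O) ->
        let lb := D `&` lbound (range s) in
        let lb' := E `&` lbound (range (f \o s)) in
        (lb `&` ubound lb) x -> (lb' `&` ubound lb') (f x)].

HB.mixin Record isLocalisable (R : realType) U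
    of FAlgebra R U & DedekindRiesz R U := {
  localisable_mul :
    sigma_order_continuous [set p : U *p U | 0 <= p.1 /\ 0 <= p.2]
      [set u : U | 0 <= u] (fun p : U *p U => falg_mul p.1 p.2);
  localisable_simple : forall u : U, 0 <= u ->
    exists s : nat -> U,
      [/\ forall n, simple (s n) /\ 0 <= s n,
          forall m n, (m <= n)%N -> s m <= s n
        & supremums (range s) u]
}.

#[short(type="localisableType")]
HB.structure Definition Localisable (R : realType) :=
  {U of FAlgebra R U & DedekindRiesz R U & isLocalisable R U}.

HB.mixin Record hasRieszDistance (R : realType) U of DedekindRiesz R U := {
  rdist : U -> U -> R;
  rdistxx : forall u, rdist u u = 0;
  rdist_eq0 : forall u v, rdist u v = 0 -> u = v;
  rdist_sym : forall u v, rdist u v = rdist v u;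
  rdist_triangle : forall v u w, rdist u w <= rdist u v + rdist v w;
  rdist_abs : forall u : U, rdist u 0 = rdist (absr u) 0;
  rdist_add : forall u v w : U, rdist (u + w) (v + w) = rdist u v;
  rdist_mono : forall u v : U, 0 <= u -> u <= v -> rdist u 0 <= rdist v 0
}.

#[short(type="distRieszType")]
HB.structure Definition DistRiesz (R : realType) :=
  {U of DedekindRiesz R U & hasRieszDistance R U}.

(* [U] as a library metric space; an alias, since [GRing.Zmodule] and [Metric]
   have no join either. *)
Definition riesz_metric (R : realType) (U : distRieszType R) : Type := U.

HB.instance Definition _ (R : realType) (U : distRieszType R) :=
  Choice.on (riesz_metric U).
HB.instance Definition _ (R : realType) (U : distRieszType R) :=
  isMetric.Build R (riesz_metric U) (@rdistxx R U) (@rdist_eq0 R U)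
    (@rdist_sym R U) (@rdist_triangle R U).

Definition complete_space (T : uniformType) :=
  forall G : set_system T, ProperFilter G -> cauchy G -> exists x : T, G --> x.

HB.mixin Record isMetricRiesz (R : realType) U of DistRiesz R U := {
  riesz_metric_complete : complete_space (riesz_metric U)
}.

#[short(type="metricRieszType")]
HB.structure Definition MetricRiesz (R : realType) :=
  {U of DistRiesz R U & isMetricRiesz R U}.

HB.mixin Record isMetricFAlgebra (R : realType) U
    of Localisable R U & MetricRiesz R U := {
  falg_mul_continuous : continuous
    (fun p : riesz_metric U * riesz_metric U =>
       falg_mul p.1 p.2 : riesz_metric U);
  simple_dense : dense (@simple R U : set (riesz_metric U));
  rdist_one_cvg : rdist (e *: (falg_one : U)) 0 @[e --> (0 : R)^'+] --> (0 : R)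
}.

#[short(type="metricFAlgebraType")]
HB.structure Definition MetricFAlgebra (R : realType) :=
  {U of Localisable R U & MetricRiesz R U & isMetricFAlgebra R U}.

(* A Riesz (resp. f-)subspace is given by a type together with an injective map
   into the larger space preserving the operations; the order is preserved and
   reflected since [u <= v] means [joinr u v = v]. *)
Definition riesz_embedding (R : realType) (U A : rieszType R) (i : U -> A) :=
  [/\ injective i, linear i,
      {morph i : u v / joinr u v}
    & {morph i : u v / meetr u v}].

Definition falgebra_embedding (R : realType) (U A : fAlgebraType R)
    (i : U -> A) :=
  [/\ riesz_embedding i, {morph i : u v / falg_mul u v} & i falg_one = falg_one].

Record metricFStructure (R : realType) := MetricFStructure {
  fs_amb : localisableType R;
  fs_alg : metricFAlgebraType R;
  fs_val : metricRieszType R;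
  fs_ialg : fs_alg -> fs_amb;
  fs_ival : fs_val -> fs_amb;
  (* the product of [fs_amb] as a map with values in [fs_val] *)
  fs_mul : fs_alg -> fs_val -> fs_val;
  fs_ialg_embedding : falgebra_embedding fs_ialg;
  fs_ialg_solid : solid (range fs_ialg);
  fs_ival_embedding : riesz_embedding fs_ival;
  fs_ival_solid : solid (range fs_ival);
  fs_mul_range :
    [set falg_mul (fs_ialg u) (fs_ival v) | u in setT & v in setT]
    = range fs_ival;
  fs_mulE : forall u v, fs_ival (fs_mul u v) = falg_mul (fs_ialg u) (fs_ival v);
  fs_mul_continuous : continuous
    (fun p : riesz_metric fs_alg * riesz_metric fs_val =>
       fs_mul p.1 p.2 : riesz_metric fs_val);
  fs_small_sup : forall (u : nat -> fs_alg) (e : R),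
    countable_partition falg_one u -> 0 < e ->
    exists2 d : R, 0 < d &
      forall v : nat -> fs_val, (forall n, 0 <= v n) ->
        (\sum_(0 <= n <oo) (rdist (fs_mul (u n) (v n)) 0)%:E <= d%:E)%E ->
        order_bounded (range (fun n => fs_mul (u n) (v n))) /\
        exists2 w, supremums (range (fun n => fs_mul (u n) (v n))) w &
          rdist w 0 <= e
}.

HB.mixin Record isVNormedModule (R : realType) (F : metricFStructure R) M
    of GRing.Lmodule (falg_ring (fs_alg F)) M := {
  pnorm : M -> fs_val F;
  pnorm_ge0 : forall v, 0 <= pnorm v;
  pnorm_eq0 : forall v, pnorm v = 0 <-> v = 0;
  pnormD : forall v w, pnorm (v + w) <= pnorm v + pnorm w;
  pnormZ : forall (u : falg_ring (fs_alg F)) v,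
    pnorm (u *: v) = fs_mul (absr u) (pnorm v);
  pnorm_glueing : forall (u : nat -> falg_ring (fs_alg F)) (v : nat -> M),
    countable_partition falg_one u ->
    order_bounded (range (fun n => pnorm (u n *: v n))) ->
    exists w, forall n, u n *: w = u n *: v n
}.

#[short(type="vNormedModType")]
HB.structure Definition VNormedModule (R : realType) (F : metricFStructure R) :=
  {M of GRing.Lmodule (falg_ring (fs_alg F)) M & isVNormedModule R F M}.

Definition module_metric (R : realType) (F : metricFStructure R)
  (M : vNormedModType F) : Type := M.

Section ModuleMetric.
Context (R : realType) (F : metricFStructure R) (M : vNormedModType F).

Definition module_dist (v w : M) : R := rdist (pnorm (v - w)) 0.

Let absrN (U : rieszType R) (u : U) : absr (- u) = absr u.
Proof.
rewrite /absr opprK; have [ub1 lub1] := joinr_sup (- u) u.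
have [ub2 lub2] := joinr_sup u (- u).
by apply/le_anti/andP; split; [apply: lub1 | apply: lub2] => x [] ->;
  [apply: ub2; right | apply: ub2; left | apply: ub1; right | apply: ub1; left].
Qed.

Let pnormN (v : M) : pnorm (- v) = pnorm v.
Proof.
rewrite -scaleN1r -[in RHS](scale1r v) !pnormZ.
by congr (fs_mul _ _); exact: (@absrN (fs_alg F)).
Qed.

Let module_distxx (v : M) : module_dist v v = 0.
Proof. by rewrite /module_dist subrr (pnorm_eq0 _).2// rdistxx. Qed.

Let module_dist_eq0 (v w : M) : module_dist v w = 0 -> v = w.
Proof. by move/rdist_eq0/pnorm_eq0/subr0_eq. Qed.

Let module_dist_sym (v w : M) : module_dist v w = module_dist w v.
Proof. by rewrite /module_dist -opprB pnormN. Qed.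

Let module_dist_triangle (v u w : M) :
  module_dist u w <= module_dist u v + module_dist v w.
Proof.
have le1 : module_dist u w <= rdist (pnorm (u - v) + pnorm (v - w)) 0.
  by apply: rdist_mono; rewrite ?pnorm_ge0// -(subrKA v) pnormD.
apply: (le_trans le1); apply: (le_trans (rdist_triangle (pnorm (v - w)) _ _)).
by rewrite -{2}[pnorm (v - w)]add0r rdist_add.
Qed.

HB.instance Definition _ := Choice.on (module_metric M).
HB.instance Definition _ := isMetric.Build R (module_metric M)
  module_distxx module_dist_eq0 module_dist_sym module_dist_triangle.

End ModuleMetric.

HB.mixin Record isVBanachModule (R : realType) (F : metricFStructure R) M
    of VNormedModule R F M := {
  module_complete : complete_space (module_metric M)
}.

#[short(type="vBanachModType")]
HB.structure Definition VBanachModule (R : realType) (F : metricFStructure R) :=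
  {M of VNormedModule R F M & isVBanachModule R F M}.

Section Generated.
Context (R : realType) (F : metricFStructure R).

Definition admissible (M : vNormedModType F)
    (u : nat -> falg_ring (fs_alg F)) (v : nat -> M) :=
  countable_partition falg_one u /\
  order_bounded (range (fun n => pnorm (u n *: v n))).

(* [w] is the glued sum of the [u n *: v n]. *)
Definition glue_set (M : vNormedModType F) (S : set M) : set M :=
  [set w | exists (u : nat -> falg_ring (fs_alg F)) (v : nat -> M),
     [/\ admissible u v, forall n, S (v n)
       & forall n, u n *: w = u n *: v n]].

Context (W : lmodType R).

Definition sublinear (psi : W -> fs_val F) :=
  [/\ forall x, 0 <= psi x,
      forall (l : R) x, 0 <= l -> psi (l *: x) = l *: psi x
    & forall x y, psi (x + y) <= psi x + psi y].

Definition symmetric_map (psi : W -> fs_val F) := forall x, psi (- x) = psi x.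

(* Real scalars act on a module by [l v := (l *: falg_one) *: v]. *)
Definition real_linear (M : vBanachModType F) (T : W -> M) :=
  GRing.linear_for (fun (l : R) (v : M) =>
    (l *: (falg_one : fs_alg F) : falg_ring (fs_alg F)) *: v) T.

Definition is_generated (psi : W -> fs_val F) (M : vBanachModType F)
    (T : W -> M) :=
  [/\ real_linear T, forall x, pnorm (T x) = psi x
    & dense (glue_set (range T) : set (module_metric M))].

Definition banach_hom (M N : vBanachModType F) (Phi : M -> N) :=
  linear Phi /\ forall v, pnorm (Phi v) <= pnorm v.

Definition cpsi_object (psi : W -> fs_val F) (M : vBanachModType F)
    (T : W -> M) :=
  real_linear T /\ forall x, pnorm (T x) <= psi x.

Definition cpsi_hom (M N : vBanachModType F) (T : W -> M) (T' : W -> N)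
    (Phi : M -> N) :=
  banach_hom Phi /\ Phi \o T = T'.

Definition cpsi_initial (psi : W -> fs_val F) (M : vBanachModType F)
    (T : W -> M) :=
  cpsi_object psi T /\
  forall (N : vBanachModType F) (T' : W -> N), cpsi_object psi T' ->
    exists! Phi : M -> N, cpsi_hom T T' Phi.

End Generated.

(* Main.v *)
Require Import Defs.
From HB Require Import structures.
From mathcomp Require Import all_boot all_order all_algebra.
From mathcomp Require Import all_classical all_reals all_analysis.

Import Order.TTheory GRing.Theory Num.Theory.
Import metricType_numDomainType.
Local Open Scope classical_set_scope.
Local Open Scope ring_scope.

Set Implicit Arguments.
Unset Strict Implicit.
Unset Printing Implicit Defensive.

(** The morphism is determined by what it must do to glued elements.  If, on
    the blocks of a countable partition of the unit, [m] coincides with vectors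
    [T x_k], then its image has to coincide on the same blocks with [T' x_k].
    Let the graph be the set of pairs [(m, n)] that match in this way
    ([glued_graph]).  Blockwise the norm of [n] is that of [T' x_k], which is
    at most that of [T x_k], so the norm of [n] is at most that of [m]
    ([glued_graph_le]).  For the same reason the images of an admissible family
    are admissible and can be glued, so the first projection of the graph is
    dense ([glued_graph_dense]).  On common refinements of partitions the graph
    is stable under combinations with simple coefficients
    ([glued_graph_simple]), because there a simple element acts as a real and
    [T] and [T'] are real linear.

    Density of simple elements, continuity of the action and completeness then
    show that the closure of the graph is the graph of an everywhere defined
    linear contraction ([graph_closure_linear], [graph_closure_functional],
    [graph_closure_total]).  It sends [T x] to [T' x], and any other such
    contraction has its graph inside the closure ([hom_in_closure]), hence is
    equal to it.

    Passing from blocks to the whole rests on [partition_le0]: a value that is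
    nonpositive on every block of a partition of the unit is nonpositive.  This
    property alone is used to say that blocks cover the unit. *)

(** * Riesz spaces *)

Section RieszTheory.
Context (R : realType) (U : rieszType R).
Implicit Types u v w x : U.

Lemma rle_add2r u v w : (u + w <= v + w) = (u <= v).
Proof.
apply/idP/idP => [h|]; last exact: riesz_leD2r.
by rewrite -(addrK w u) -(addrK w v); exact: riesz_leD2r.
Qed.

Lemma rle_add u v w x : u <= v -> w <= x -> u + w <= v + x.
Proof.
move=> uv wx; apply: (@le_trans _ _ (v + w)); first by rewrite rle_add2r.
by rewrite ![v + _]addrC rle_add2r.
Qed.

Lemma rsub_ge0 u v : (0 <= v - u) = (u <= v).
Proof. by rewrite -[LHS](rle_add2r _ _ u) add0r subrK. Qed.

Lemma rle_subr u v w : (u <= v - w) = (u + w <= v).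
Proof. by rewrite -[LHS](rle_add2r _ _ w) subrK. Qed.

Lemma rle_subl u v w : (u - w <= v) = (u <= v + w).
Proof. by rewrite -[LHS](rle_add2r _ _ w) subrK. Qed.

Lemma rsub_le0 u v : (u - v <= 0) = (u <= v).
Proof. by rewrite rle_subl add0r. Qed.

Lemma roppr_le0 u : (- u <= 0) = (0 <= u).
Proof. by rewrite -[- u]add0r rsub_le0. Qed.

Lemma join_ubl u v : u <= joinr u v.
Proof. by have [ub _] := joinr_sup u v; apply: ub; left. Qed.

Lemma join_ubr u v : v <= joinr u v.
Proof. by have [ub _] := joinr_sup u v; apply: ub; right. Qed.

Lemma join_lub u v w : u <= w -> v <= w -> joinr u v <= w.
Proof.
by move=> uw vw; have [_ lub] := joinr_sup u v; apply: lub => _ [->|->].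
Qed.

Lemma meet_lbl u v : meetr u v <= u.
Proof. by have [lb _] := meetr_inf u v; apply: lb; left. Qed.

Lemma meet_lbr u v : meetr u v <= v.
Proof. by have [lb _] := meetr_inf u v; apply: lb; right. Qed.

Lemma meet_glb u v w : w <= u -> w <= v -> w <= meetr u v.
Proof.
by move=> wu wv; have [_ glb] := meetr_inf u v; apply: glb => _ [->|->].
Qed.

Lemma le_joinE u v : u <= v <-> joinr u v = v.
Proof.
split=> [uv|<-]; last exact: join_ubl.
by apply/le_anti; rewrite join_ubr join_lub.
Qed.

Lemma meet_idem u : meetr u u = u.
Proof. by apply/le_anti; rewrite meet_lbl meet_glb. Qed.

Lemma meetC u v : meetr u v = meetr v u.
Proof. by apply/le_anti; rewrite !meet_glb ?meet_lbl ?meet_lbr. Qed.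

Lemma absr_ge0_id u : 0 <= u -> absr u = u.
Proof.
move=> u0; apply/le_anti; rewrite join_ubl join_lub //.
by apply: (le_trans _ u0); rewrite roppr_le0.
Qed.

Lemma pos_sub_neg u : joinr u 0 - joinr (- u) 0 = u.
Proof.
apply/le_anti/andP; split.
  rewrite rle_subl; apply: join_lub; last first.
    by rewrite addrC -rle_subl sub0r join_ubl.
  by rewrite -[leLHS]addr0 rle_add ?join_ubr.
rewrite rle_subr addrC -rle_subr; apply: join_lub.
  by rewrite rle_subr addNr join_ubr.
by rewrite rsub_ge0 join_ubl.
Qed.

(** Anything below both parts can be subtracted from the positive part without
    leaving the upper bounds of [u] and [0]. *)
Lemma pos_meet_neg u : meetr (joinr u 0) (joinr (- u) 0) = 0.
Proof.
apply/le_anti/andP; split; last by apply: meet_glb; exact: join_ubr.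
set z := meetr _ _.
suff : joinr u 0 <= joinr u 0 - z by rewrite rle_subr addrC -rle_subr subrr.
apply: join_lub; last by rewrite rsub_ge0 meet_lbl.
rewrite rle_subr addrC -rle_subr -[X in _ <= _ - X]pos_sub_neg.
by rewrite opprB addrC subrK meet_lbr.
Qed.

Lemma le0_pos_eq0 u : joinr u 0 = 0 -> u <= 0.
Proof. by move<-; exact: join_ubl. Qed.

End RieszTheory.

(** * Idempotents of f-algebras *)

Section FAlgebraTheory.
Context (R : realType) (U : fAlgebraType R).
Implicit Types u v w p : U.

Lemma fmulDr u v w : falg_mul u (v + w) = falg_mul u v + falg_mul u w.
Proof. by rewrite !(falg_mulC u) falg_mulDl. Qed.

Lemma fmul0r u : falg_mul 0 u = 0.
Proof. by apply: (addrI (falg_mul 0 u)); rewrite -falg_mulDl !addr0. Qed.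

Lemma fmulNr u v : falg_mul (- u) v = - falg_mul u v.
Proof. by apply/eqP; rewrite -addr_eq0 -falg_mulDl addNr fmul0r. Qed.

Lemma fmulrN u v : falg_mul u (- v) = - falg_mul u v.
Proof. by rewrite falg_mulC fmulNr falg_mulC. Qed.

Lemma fmulBl u v w : falg_mul (u - v) w = falg_mul u w - falg_mul v w.
Proof. by rewrite falg_mulDl fmulNr. Qed.

Lemma fmulBr u v w : falg_mul u (v - w) = falg_mul u v - falg_mul u w.
Proof. by rewrite fmulDr fmulrN. Qed.

Lemma fmulr1 u : falg_mul u falg_one = u.
Proof. by rewrite falg_mulC falg_mul1. Qed.

Lemma fmul_le2l w u v : 0 <= w -> u <= v -> falg_mul w u <= falg_mul w v.
Proof. by move=> w0 uv; rewrite -rsub_ge0 -fmulBr falg_mul_ge0 // rsub_ge0. Qed.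

Lemma fmul_disjoint0 u v :
  0 <= u -> 0 <= v -> meetr u v = 0 -> falg_mul u v = 0.
Proof.
move=> u0 v0 uv0; have := falg_mul_disjoint _ _ _ uv0 v0.
rewrite meetC => /(falg_mul_disjoint _ _ _)/(_ u0).
by rewrite (falg_mulC v) meet_idem.
Qed.

(** With [u = a - b] its decomposition into disjoint parts, the cross terms of
    the square vanish and what is left is [a ^+ 2 + b ^+ 2]. *)
Lemma fsqr_ge0 u : 0 <= falg_mul u u.
Proof.
rewrite -[u]pos_sub_neg; set a := joinr u 0; set b := joinr (- u) 0.
have a0 : 0 <= a by exact: join_ubr.
have b0 : 0 <= b by exact: join_ubr.
have ab0 : falg_mul a b = 0 by apply: fmul_disjoint0 => //; exact: pos_meet_neg.
rewrite fmulBl !fmulBr (falg_mulC b) ab0 subr0 sub0r opprK.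
by rewrite -[0]addr0 rle_add // falg_mul_ge0.
Qed.

Lemma idem_ge0 p : idem p -> 0 <= p.
Proof. by move=> <-; exact: fsqr_ge0. Qed.

Lemma idem1 : idem (falg_one : U).
Proof. exact: falg_mul1. Qed.

Lemma fone_ge0 : 0 <= falg_one :> U.
Proof. exact: idem_ge0 idem1. Qed.

Lemma idem_compl p : idem p -> idem (falg_one - p).
Proof.
move=> pp; rewrite /idem /= fmulBl !fmulBr !falg_mul1 fmulr1 pp.
by rewrite subrr subr0.
Qed.

Lemma idemM p q : idem p -> idem q -> idem (falg_mul p q).
Proof.
rewrite /idem /= => pp qq.
rewrite falg_mulA (falg_mulC p) -(falg_mulA q) pp.
by rewrite (falg_mulC q) -falg_mulA qq.
Qed.

Lemma fone_disjoint_eq0 u : meetr falg_one u = 0 -> 0 <= u -> u = 0.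
Proof.
move=> d u0; have := falg_mul_disjoint _ _ _ d u0.
by rewrite falg_mul1 meet_idem.
Qed.

(** The product of [p] with the positive part of [v] is at most [p] times the
    negative part, hence at most the negative part itself, from which it is
    disjoint. *)
Lemma idem_mul_pos0 p v :
  idem p -> falg_mul p v <= 0 -> falg_mul p (joinr v 0) = 0.
Proof.
move=> pp pv; have p0 := idem_ge0 pp.
have a0 : 0 <= joinr v 0 by exact: join_ubr.
have b0 : 0 <= joinr (- v) 0 by exact: join_ubr.
have disj := falg_mul_disjoint _ _ _ (pos_meet_neg v) p0.
rewrite falg_mulC in disj.
apply/le_anti/andP; split; last exact: falg_mul_ge0.
rewrite -[leRHS]disj; apply: meet_glb => //.
apply: (@le_trans _ _ (falg_mul p (joinr (- v) 0))).
  by rewrite -rsub_le0 -fmulBr pos_sub_neg.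
rewrite -{2}[joinr (- v) 0]falg_mul1 !(falg_mulC _ (joinr (- v) 0)).
by apply: fmul_le2l => //; rewrite -rsub_ge0 idem_ge0 //; exact: idem_compl.
Qed.

End FAlgebraTheory.

(** A simple element acts on each block of its partition as a real scalar. *)
Lemma simple_mul_block (R : realType) (U : fAlgebraType R) (n : nat)
    (l : 'I_n -> R) (p : 'I_n -> U) (i : 'I_n) :
  finite_partition falg_one p ->
  falg_mul (p i) (\sum_(j < n) l j *: p j) = falg_mul (p i) (l i *: falg_one).
Proof.
move=> [pidem pdisj _].
have mulZr (c : R) (u v : U) : falg_mul u (c *: v) = c *: falg_mul u v.
  by rewrite falg_mulC falg_mulZl falg_mulC.
have mul_sum (I : finType) (f : I -> U) (u : U) :
    falg_mul u (\sum_j f j) = \sum_j falg_mul u (f j).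
  apply: (big_morph (falg_mul u)); first exact: fmulDr.
  by rewrite falg_mulC fmul0r.
rewrite mul_sum (bigD1 i) //= big1 => [|j ji].
  by rewrite addr0 !mulZr fmulr1 pidem.
rewrite mulZr fmul_disjoint0 ?scaler0 //; [exact: idem_ge0..|].
rewrite -(absr_ge0_id (idem_ge0 (pidem i))) -(absr_ge0_id (idem_ge0 (pidem j))).
by apply: pdisj => ij; rewrite ij eqxx in ji.
Qed.

Section Embedding.
Context (R : realType) (U A : rieszType R) (i : U -> A).
Context (hi : riesz_embedding i).

Lemma embedding_add : {morph i : u v / u + v}.
Proof. by move: hi => [_ il _ _] u v; have := il 1 u v; rewrite !scale1r. Qed.

Lemma embedding0 : i 0 = 0.
Proof. by apply: (addrI (i 0)); rewrite -embedding_add !addr0. Qed.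

Lemma embeddingN : {morph i : u / - u}.
Proof.
by move=> u; apply/eqP; rewrite -addr_eq0 -embedding_add addNr embedding0.
Qed.

Lemma embedding_le u v : (i u <= i v) = (u <= v).
Proof.
move: hi => [inj _ ij _]; apply/idP/idP => /le_joinE h; apply/le_joinE.
  by apply: inj; rewrite ij.
by rewrite -ij h.
Qed.

End Embedding.

(** * The action of the algebra on the value space *)

Section FStructureTheory.
Context (R : realType) (F : metricFStructure R).
Implicit Types (a b p : fs_alg F) (u v w : fs_val F).

Lemma ialg_riesz : riesz_embedding (@fs_ialg R F).
Proof. by case: (fs_ialg_embedding F). Qed.

Lemma ialgM : {morph @fs_ialg R F : a b / falg_mul a b}.
Proof. by case: (fs_ialg_embedding F). Qed.

Lemma ialg1 : fs_ialg (falg_one : fs_alg F) = falg_one.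
Proof. by case: (fs_ialg_embedding F). Qed.

Let ivD := embedding_add (fs_ival_embedding F).

Lemma ival_inj : injective (@fs_ival R F).
Proof. by case: (fs_ival_embedding F). Qed.

Lemma act_mul a b v : fs_mul (falg_mul a b) v = fs_mul a (fs_mul b v).
Proof. by apply: ival_inj; rewrite !fs_mulE ialgM falg_mulA. Qed.

Lemma act1 v : fs_mul falg_one v = v.
Proof. by apply: ival_inj; rewrite fs_mulE ialg1 falg_mul1. Qed.

Lemma actDl a b v : fs_mul (a + b) v = fs_mul a v + fs_mul b v.
Proof.
by apply: ival_inj; rewrite ivD !fs_mulE (embedding_add ialg_riesz) falg_mulDl.
Qed.

Lemma actDr a u v : fs_mul a (u + v) = fs_mul a u + fs_mul a v.
Proof. by apply: ival_inj; rewrite ivD !fs_mulE ivD fmulDr. Qed.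

Lemma act0r v : fs_mul 0 v = 0 :> fs_val F.
Proof. by apply: (addrI (fs_mul 0 v)); rewrite -actDl !addr0. Qed.

Lemma actr0 a : fs_mul a 0 = 0 :> fs_val F.
Proof. by apply: (addrI (fs_mul a 0)); rewrite -actDr !addr0. Qed.

Lemma actBr a u v : fs_mul a (u - v) = fs_mul a u - fs_mul a v.
Proof.
rewrite actDr; congr (_ + _); apply/eqP.
by rewrite -addr_eq0 -actDr addNr actr0.
Qed.

Lemma act_ge0 a v : 0 <= a -> 0 <= v -> 0 <= fs_mul a v.
Proof.
move=> a0 v0; rewrite -(embedding_le (fs_ival_embedding F)).
rewrite (embedding0 (fs_ival_embedding F)) fs_mulE falg_mul_ge0 //.
  by rewrite -(embedding0 ialg_riesz) (embedding_le ialg_riesz).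
rewrite -(embedding0 (fs_ival_embedding F)).
by rewrite (embedding_le (fs_ival_embedding F)).
Qed.

Lemma act_le a u v : 0 <= a -> u <= v -> fs_mul a u <= fs_mul a v.
Proof. by move=> a0 uv; rewrite -rsub_ge0 -actBr act_ge0 // rsub_ge0. Qed.

(** A countable partition of the unit detects the sign of a value.  In the
    ambient algebra put [w] for the positive part of [v]; every [p k] kills
    [w], hence also [e = meetr 1 w], which lies in the algebra because the
    latter is solid.  Thus [e] is below [1 - p k], so [1 - e] is an upper bound
    of the partition and [e = 0].  As [1] is disjoint from nothing but [0],
    [w = 0]. *)
Lemma partition_le0 (p : nat -> fs_alg F) v :
  countable_partition falg_one p -> (forall k, fs_mul (p k) v <= 0) -> v <= 0.
Proof.
move=> [pidem _ [_ plub]] pv.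
have va : riesz_embedding (@fs_ival R F) := fs_ival_embedding F.
have aa := ialg_riesz.
have p0 k : 0 <= p k by exact: idem_ge0.
have iidem k : idem (fs_ialg (p k)) by rewrite /idem /= -ialgM pidem.
rewrite -(embedding_le va) (embedding0 va); apply: le0_pos_eq0.
set w := joinr _ 0; have w0 : 0 <= w by exact: join_ubr.
have pw k : falg_mul (fs_ialg (p k)) w = 0.
  apply: idem_mul_pos0 => //; rewrite -fs_mulE -(embedding0 va).
  by rewrite (embedding_le va).
have e0 : 0 <= meetr falg_one w by apply: meet_glb => //; exact: fone_ge0.
have [e _ ie] : range (@fs_ialg R F) (meetr falg_one w).
  apply: (@fs_ialg_solid R F falg_one).
    by exists falg_one => //; exact: ialg1.
  by rewrite !absr_ge0_id ?fone_ge0 // meet_lbl.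
apply: fone_disjoint_eq0 => //; apply/le_anti; rewrite e0 andbT.
rewrite -ie -(embedding0 aa) (embedding_le aa).
suff : falg_one <= falg_one - e by rewrite rle_subr addrC -rle_subr subrr.
apply: plub => _ [k _ <-].
rewrite rle_subr addrC -rle_subr -(embedding_le aa).
rewrite (embedding_add aa) (embeddingN aa) ialg1 ie.
set q := falg_one - _; have q0 : 0 <= q by apply: idem_ge0; exact: idem_compl.
have pe : falg_mul (fs_ialg (p k)) (meetr falg_one w) = 0.
  apply/le_anti/andP; split; last by apply: falg_mul_ge0 => //; exact: idem_ge0.
  by rewrite -[leRHS](pw k) fmul_le2l ?idem_ge0 // meet_lbr.
rewrite -[leRHS]fmulr1; apply: (@le_trans _ _ (falg_mul q (meetr falg_one w))).
  by rewrite fmulBl falg_mul1 pe subr0.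
by apply: fmul_le2l => //; exact: meet_lbl.
Qed.

(** * Distances *)

Lemma rdist_ge0 (V : distRieszType R) (x y : V) : 0 <= rdist x y.
Proof. exact: (@mdist_ge0 R (riesz_metric V)). Qed.

Lemma rdistD (V : distRieszType R) (x y : V) :
  rdist (x + y) 0 <= rdist x 0 + rdist y 0.
Proof.
by apply: (le_trans (rdist_triangle y _ _)); rewrite -{2}[y]add0r rdist_add.
Qed.

Lemma rdist_absB (V : distRieszType R) (x y : V) :
  rdist (absr (x - y)) 0 = rdist x y.
Proof. by rewrite -rdist_abs -(subrr y) rdist_add. Qed.

(** Domination by arbitrarily small elements forces the positive part to have
    distance [0] from the origin. *)
Lemma le0_small_dominated (V : distRieszType R) (x : V) :
  (forall e : R, 0 < e -> exists c, [/\ 0 <= c, x <= c & rdist c 0 < e]) ->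
  x <= 0.
Proof.
move=> h; apply: le0_pos_eq0; apply: rdist_eq0.
apply/le_anti; rewrite rdist_ge0 andbT; apply/ler_addgt0Pl => e e0.
have [c [c0 xc ce]] := h e e0; rewrite addr0.
apply: (le_trans _ (ltW ce)); apply: rdist_mono; first exact: join_ubr.
exact: join_lub.
Qed.

Lemma act_small a v (e : R) : 0 < e ->
  exists2 d : R, 0 < d & forall b w, rdist a b < d -> rdist v w < d ->
    rdist (fs_mul a v) (fs_mul b w) < e.
Proof.
move=> e0.
have /cvgrPdist_lt/(_ e e0) := @fs_mul_continuous R F (a, v).
move=> [[A B] /= [/nbhs_ballP [d1 /= d10 A1] /nbhs_ballP [d2 /= d20 B2]] AB].
exists (Num.min d1 d2) => [|b w]; first by rewrite lt_min d10.
rewrite !lt_min => /andP[b1 _] /andP[_ w2].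
apply: (AB (b, w)); split => /=; [apply: A1 | apply: B2];
  by rewrite -ball_mdistE.
Qed.

Lemma simple_near a (d : R) : 0 < d -> exists2 s, simple s & rdist a s < d.
Proof.
move=> d0.
pose x := a : riesz_metric (fs_alg F).
have [s [/interior_subset ds ss]] := simple_dense (ball x d)°
  (ex_intro _ x (@nbhsx_ballx _ _ x d d0)) (open_interior _).
by exists s => //; move: ds; rewrite -ball_mdistE.
Qed.

End FStructureTheory.

(** * Normed modules *)

Section ModuleTheory.
Context (R : realType) (F : metricFStructure R) (M : vNormedModType F).
Implicit Types (m : M) (a p : falg_ring (fs_alg F)).

Lemma pnorm0 : pnorm (0 : M) = 0.
Proof. exact/pnorm_eq0. Qed.

Lemma pnorm_idem p m : idem p -> pnorm (p *: m) = fs_mul p (pnorm m).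
Proof. by move=> /idem_ge0 p0; rewrite pnormZ absr_ge0_id. Qed.

Lemma module_dist_sym m1 m2 : module_dist m1 m2 = module_dist m2 m1.
Proof. exact: (@metric_sym R (module_metric M)). Qed.

Lemma module_dist_triangle m2 m1 m3 :
  module_dist m1 m3 <= module_dist m1 m2 + module_dist m2 m3.
Proof. exact: (@metric_triangle R (module_metric M)). Qed.

Lemma module_distxx m : module_dist m m = 0.
Proof. exact: (@mdistxx R (module_metric M)). Qed.

Lemma module_distD m1 m2 m3 m4 :
  module_dist (m1 + m2) (m3 + m4) <= module_dist m1 m3 + module_dist m2 m4.
Proof.
rewrite /module_dist opprD addrACA; apply: le_trans (rdistD _ _).
by apply: rdist_mono; [exact: pnorm_ge0 | exact: pnormD].
Qed.

Lemma pnorm_le_add m1 m2 : pnorm m1 <= pnorm m2 + pnorm (m1 - m2).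
Proof. by rewrite addrC -{1}(subrK m2 m1) pnormD. Qed.

Lemma scale_near_scalar a m (e : R) : 0 < e ->
  exists2 d : R, 0 < d & forall b : falg_ring (fs_alg F),
    rdist (a : fs_alg F) b < d ->
    module_dist (a *: m) (b *: m) < e.
Proof.
move=> e0; have [d d0 h] := act_small 0 (pnorm m) e0.
exists d => // b ab; rewrite /module_dist -scalerBl pnormZ rdist_sym.
rewrite -(act0r (pnorm m)); apply: h; last by rewrite rdistxx.
by rewrite rdist_sym (@rdist_absB R (fs_alg F)).
Qed.

Lemma scale_near_vector a (e : R) : 0 < e ->
  exists2 d : R, 0 < d & forall m m', module_dist m m' < d ->
    module_dist (a *: m) (a *: m') < e.
Proof.
move=> e0; have [d d0 h] := act_small (absr (a : fs_alg F)) 0 e0.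
exists d => // m m' mm'; rewrite /module_dist -scalerBr pnormZ rdist_sym.
rewrite -(actr0 (absr (a : fs_alg F))); apply: h; first by rewrite rdistxx.
by rewrite rdist_sym.
Qed.

Lemma dense_near (S : set M) m (e : R) : dense (S : set (module_metric M)) ->
  0 < e -> exists2 m', S m' & module_dist m m' < e.
Proof.
move=> Sd e0; pose x := m : module_metric M.
have [s [/interior_subset ds ss]] := Sd (ball x e)°
  (ex_intro _ x (@nbhsx_ballx _ _ x e e0)) (open_interior _).
by exists s => //; move: ds; rewrite -ball_mdistE.
Qed.

End ModuleTheory.

(** * Comparison of two modules under the same vector space *)

Section Extension.
Context (R : realType) (F : metricFStructure R) (W : lmodType R).
Context (M N : vBanachModType F) (T : W -> M) (T' : W -> N).
Context (T_lin : real_linear T) (T'_lin : real_linear T').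
Context (T'_le : forall x, pnorm (T' x) <= pnorm (T x)).
Implicit Types (m : M) (n : N) (p : falg_ring (fs_alg F)).

Definition matched_on p m n :=
  idem p /\ exists x, p *: m = p *: T x /\ p *: n = p *: T' x.

(** [m] and [n] are glued, blockwise, from the same vectors.  That the blocks
    cover the unit is expressed by their detecting the sign of values: unlike
    countable partitions, families with this property can be refined by each
    other without renumbering. *)
Definition glued_graph m n :=
  forall v, (forall p, matched_on p m n -> fs_mul p v <= 0) -> v <= 0.

Lemma glued_graph_T x : glued_graph (T x) (T' x).
Proof.
move=> v h; rewrite -[v]act1; apply: h; split; first exact: idem1.
by exists x.
Qed.

Lemma glued_graph_partition (p : nat -> falg_ring (fs_alg F))
    (x : nat -> W) m n :
  countable_partition falg_one p ->
  (forall k, p k *: m = p k *: T (x k)) ->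
  (forall k, p k *: n = p k *: T' (x k)) -> glued_graph m n.
Proof.
move=> pp pm pn v h; apply: (partition_le0 pp) => k; apply: h.
by split; [case: pp | exists (x k)].
Qed.

(** The difference of the two norms is nonpositive on each block, where it
    compares the norms of [T' x] and [T x]. *)
Lemma glued_graph_le m n : glued_graph m n -> pnorm n <= pnorm m.
Proof.
move=> mn; rewrite -rsub_le0; apply: mn => p [pp [x [pm pn]]].
rewrite actBr rsub_le0 -!pnorm_idem // pm pn !pnorm_idem //.
by apply: act_le => //; exact: idem_ge0.
Qed.

(** On a product of a block for [(m1, n1)], a block for [(m2, n2)] and a block
    of [s], where [s] is the real [l i], the combination is given by the vector
    [l i *: x + y].  The last kind of block sums up to the unit. *)
Lemma glued_graph_simple (s : falg_ring (fs_alg F)) m1 n1 m2 n2 : simple s ->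
  glued_graph m1 n1 -> glued_graph m2 n2 ->
  glued_graph (s *: m1 + m2) (s *: n1 + n2).
Proof.
move=> [k [l [q [qpart ->]]]] g1 g2 v hv.
apply: g1 => p1 [p1i [x [m1x n1x]]]; apply: g2 => p2 [p2i [y [m2y n2y]]].
have [qidem _ qsum] := qpart.
rewrite -[fs_mul p2 _]act1 -qsum.
have act_sum : fs_mul (\sum_(i < k) q i) (fs_mul p2 (fs_mul p1 v)) =
    \sum_(i < k) fs_mul (q i) (fs_mul p2 (fs_mul p1 v)).
  apply: (big_morph (fun a => fs_mul a _)) => [a b|]; first exact: actDl.
  exact: act0r.
rewrite act_sum; elim/big_ind : _ => // [a b a0 b0|i _].
  by rewrite -[0]addr0 rle_add.
rewrite -!act_mul; apply: hv; split.
  by apply: idemM => //; apply: idemM.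
exists (l i *: x + y); rewrite T_lin T'_lin.
pose qi : falg_ring (fs_alg F) := q i.
pose sq : falg_ring (fs_alg F) := \sum_(j < k) l j *: q j.
pose c : falg_ring (fs_alg F) := l i *: (falg_one : fs_alg F).
have qs : qi * sq = qi * c by exact: simple_mul_block.
have step (K : lmodType (falg_ring (fs_alg F))) (m m' t t' : K) :
    p1 *: m = p1 *: t -> p2 *: m' = p2 *: t' ->
    (qi * p2 * p1) *: (sq *: m + m') = (qi * p2 * p1) *: (c *: t + t').
  move=> mt mt'; rewrite !scalerDr; congr (_ + _).
    have swap z : qi * p2 * p1 * z = p2 * (qi * z) * p1.
      by rewrite [LHS]mulrAC (mulrC qi p2) (mulrA p2).
    by rewrite !scalerA !swap qs -!scalerA mt.
  by rewrite mulrAC -!scalerA mt'.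
by split; exact: step.
Qed.

Lemma glued_graph_dist m1 n1 m2 n2 : glued_graph m1 n1 -> glued_graph m2 n2 ->
  module_dist n1 n2 <= module_dist m1 m2.
Proof.
move=> g1 g2; rewrite module_dist_sym (module_dist_sym m1).
apply: rdist_mono; first exact: pnorm_ge0.
apply: glued_graph_le.
(* The difference is the combination with coefficient [-1], a simple element. *)
pose c : falg_ring (fs_alg F) := -1.
have : glued_graph (c *: m1 + m2) (c *: n1 + n2).
  apply: glued_graph_simple => //; exists 1%N, (fun=> -1), (fun=> falg_one).
  split; last by rewrite big_ord1 scaleN1r.
  split; [by move=> i; exact: idem1 | | by rewrite big_ord1].
  by move=> i j; rewrite !ord1.
by rewrite !scaleN1r ![- _ + _]addrC.
Qed.

Definition graph_closure m n := forall e : R, 0 < e -> exists m' n',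
  [/\ glued_graph m' n', module_dist m m' < e & module_dist n n' < e].

Lemma graph_closure_T x : graph_closure (T x) (T' x).
Proof.
move=> e e0; exists (T x), (T' x).
by split; rewrite ?module_distxx //; exact: glued_graph_T.
Qed.

(** A general scalar is first approximated by a simple one [s]; only then can
    the pairs be approximated, the modulus of continuity of multiplication by
    [s] depending on [s]. *)
Lemma graph_closure_linear a m1 n1 m2 n2 : graph_closure m1 n1 ->
  graph_closure m2 n2 -> graph_closure (a *: m1 + m2) (a *: n1 + n2).
Proof.
move=> g1 g2 e e0; have e3 : 0 < e / 3 by rewrite divr_gt0.
have [dM dM0 aM] := scale_near_scalar a m1 e3.
have [dN dN0 aN] := scale_near_scalar a n1 e3.
have dd0 : 0 < Num.min dM dN by rewrite lt_min dM0.
have [s ss] := simple_near a dd0; rewrite lt_min => /andP[/aM asM /aN asN].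
have [rM rM0 sM] := scale_near_vector M s e3.
have [rN rN0 sN] := scale_near_vector N s e3.
have rr0 : 0 < Num.min rM rN by rewrite lt_min rM0.
have [m1' [n1' [g1' + +]]] := g1 _ rr0.
rewrite !lt_min => /andP[/sM sM1 _] /andP[_ /sN sN1].
have [m2' [n2' [g2' m2e n2e]]] := g2 _ e3.
exists ((s : falg_ring (fs_alg F)) *: m1' + m2').
exists ((s : falg_ring (fs_alg F)) *: n1' + n2').
have third : e = (e / 3 + e / 3) + e / 3.
  by rewrite -mulr2n -mulrSr -[RHS]mulr_natr mulfVK // pnatr_eq0.
split; first exact: glued_graph_simple.
  rewrite third; apply: (le_lt_trans (module_distD _ _ _ _)); apply: ltrD => //.
  by apply: (le_lt_trans (module_dist_triangle _ _ _)); exact: ltrD asM sM1.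
rewrite third; apply: (le_lt_trans (module_distD _ _ _ _)); apply: ltrD => //.
by apply: (le_lt_trans (module_dist_triangle _ _ _)); exact: ltrD asN sN1.
Qed.

(** The two norms differ by at most the error of approximating [(m, n)] in the
    graph, an element of arbitrarily small distance to [0]. *)
Lemma graph_closure_le m n : graph_closure m n -> pnorm n <= pnorm m.
Proof.
move=> mn; rewrite -rsub_le0; apply: le0_small_dominated => e e0.
have [m' [n' [g mm' nn']]] := mn _ (divr_gt0 e0 (ltr0Sn R 1)).
exists (pnorm (m' - m) + pnorm (n - n')); split.
- by rewrite -[0]addr0 rle_add ?pnorm_ge0.
- rewrite rle_subl; apply: (le_trans (pnorm_le_add n n')).
  rewrite addrAC rle_add2r addrC; apply: (le_trans (glued_graph_le g)).
  exact: pnorm_le_add.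
- rewrite (splitr e); apply: (le_lt_trans (rdistD _ _)).
  by apply: ltrD => //; rewrite -/(module_dist m' m) module_dist_sym.
Qed.

(** The difference of two pairs over [m] is a pair over [0], and the bound on
    norms makes it vanish. *)
Lemma graph_closure_functional m n n' :
  graph_closure m n -> graph_closure m n' -> n = n'.
Proof.
move=> g g'; have := graph_closure_linear (-1) g g'.
rewrite !scaleN1r addNr => /graph_closure_le; rewrite pnorm0 => le0.
apply/esym/eqP; rewrite -subr_eq0 addrC; apply/eqP/pnorm_eq0/le_anti.
by rewrite le0 pnorm_ge0.
Qed.

Context (T_dense : dense (glue_set (range T) : set (module_metric M))).

(** An element glued from vectors [T (x k)] has a counterpart glued from the
    [T' (x k)]: the norms of the latter blocks are dominated by those of the
    former, so the family is admissible. *)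
Lemma glued_graph_dense m (e : R) : 0 < e ->
  exists m' n', glued_graph m' n' /\ module_dist m m' < e.
Proof.
move=> /(dense_near m T_dense) [m' [p [t [[pp [_ tub]] tT pm']]] mm'].
have /choice [x tE] k : exists x, T x = t k by have [x _ <-] := tT k; exists x.
have [n pn] : exists n, forall k, p k *: n = p k *: T' (x k).
  apply: pnorm_glueing => //; split.
    by exists 0 => _ [k _ <-]; exact: pnorm_ge0.
  have [b tb] := tub; exists b => _ [k _ <-].
  apply: (@le_trans _ _ (pnorm (p k *: t k))); last by apply: tb; exists k.
  have pk : idem (p k) by case: pp.
  by rewrite !pnorm_idem // -tE act_le // idem_ge0.
exists m', n; split => //; apply: (glued_graph_partition pp (x := x)) => // k.
by rewrite tE pm'.
Qed.

(** Since the correspondence does not increase distances, the second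
    components of pairs of [glued_graph] whose first component tends to [m]
    form a Cauchy filter. *)
Lemma graph_closure_total m : exists n, graph_closure m n.
Proof.
pose B (e : R) : set (module_metric N) :=
  [set n | exists m', glued_graph m' n /\ module_dist m m' < e].
pose G := filter_from [set e : R | 0 < e] B.
have GF : Filter G.
  apply: filter_from_filter => [|i j /= i0 j0]; first by exists 1; exact: ltr01.
  exists (Num.min i j); first by rewrite /= lt_min i0.
  by move=> n [m' [g]]; rewrite lt_min => /andP[mi mj]; split; exists m'.
have GP : ProperFilter G.
  apply: filter_from_proper => e /= e0.
  by have [m' [n [g mm']]] := glued_graph_dense m e0; exists n, m'.
have Gc : cauchy G.
  apply/cauchy_ballP => e e0.
  have e2 : 0 < e / 2 by rewrite divr_gt0.
  exists (B (e / 2), B (e / 2)); first by split; exists (e / 2).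
  move=> [n1 n2] [/= [m1 [g1 mm1]] [m2 [g2 mm2]]].
  rewrite -ball_mdistE /=; apply: (le_lt_trans (glued_graph_dist g1 g2)).
  rewrite (splitr e); apply: (le_lt_trans (module_dist_triangle m _ _)).
  by apply: ltrD => //; rewrite module_dist_sym.
have [n Gn] := @module_complete R F N G GP Gc.
exists n => e e0; have [d /= d0 dB] := Gn _ (@nbhsx_ballx _ _ n e e0).
have de0 : 0 < Num.min d e by rewrite lt_min d0.
have [m' [n' [g]]] := glued_graph_dense m de0; rewrite lt_min => /andP[md me].
exists m', n'; split => //.
by have := dB n' (ex_intro _ m' (conj g md)); rewrite -ball_mdistE.
Qed.

(** On a block where a glued element equals some [T x], linearity forces the
    value of the morphism to equal [T' x]; so its graph over glued elements is
    in [glued_graph], and the bound on norms extends this to the closure. *)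
Lemma hom_in_closure (Phi : M -> N) m :
  cpsi_hom T T' Phi -> graph_closure m (Phi m).
Proof.
move=> [[Plin Ple] PT] e e0.
have [m' [p [t [[pp _] tT pm']]] mm'] := dense_near m T_dense e0.
have PZ a z : Phi (a *: z) = a *: Phi z.
  have P0 : Phi 0 = 0.
    by apply/pnorm_eq0/le_anti; rewrite pnorm_ge0 andbT -(pnorm0 M) Ple.
  by rewrite -[a *: z]addr0 Plin P0 addr0.
have PB z z' : Phi (z - z') = Phi z - Phi z'.
  by rewrite -[- z']scaleN1r addrC Plin scaleN1r addrC.
have /choice [x tE] k : exists x, T x = t k by have [x _ <-] := tT k; exists x.
exists m', (Phi m'); split => //.
  apply: (glued_graph_partition pp (x := x)) => k; first by rewrite tE pm'.
  by rewrite -PT /= -!PZ tE pm'.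
apply: le_lt_trans mm'; apply: rdist_mono; first exact: pnorm_ge0.
by rewrite -PB.
Qed.

Lemma exists_unique_hom : exists! Phi : M -> N, cpsi_hom T T' Phi.
Proof.
have /choice [Phi PhiG] := graph_closure_total.
have PhiE m n : graph_closure m n -> Phi m = n.
  exact: graph_closure_functional (PhiG m).
exists Phi; split; last first.
  move=> Psi /hom_in_closure Psig.
  by apply/funext => m; apply: PhiE; exact: Psig.
split; last by apply/funext => x; apply: PhiE; exact: graph_closure_T.
split=> [a m1 m2|m]; last exact: graph_closure_le.
by apply: PhiE; exact: graph_closure_linear.
Qed.

End Extension.

Theorem corollary3p22 (R : realType) (F : metricFStructure R) (W : lmodType R)
    (psi : W -> fs_val F) (psi_sublinear : sublinear psi)
    (psi_symmetric : symmetric_map psi)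
    (M : vBanachModType F) (T : W -> M) (genMT : is_generated psi T) :
  cpsi_initial psi T.
Proof.
have [T_lin T_norm T_dense] := genMT.
split; first by split=> // x; rewrite T_norm.
move=> N T' [T'_lin T'_le].
by apply: exists_unique_hom => // x; rewrite T_norm.
Qed.
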